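(* Let $\mathbb{L}$ be a lattice of finite height that is (isomorphic to) the congruence lattice of some algebra in a congruence modular variety. Then the following are equivalent: (1) $\mathbb{L}$ forces solvability in the class of algebras generating congruence modular varieties. (2) Every algebra $\mathbf{B}$ generating a congruence modular variety with $\mathrm{Con}(\mathbf{B}) \cong \mathbb{L}$ is solvable. (3) The two element lattice $\mathbb{B}_2$ is not a homomorphic image of $\mathbb{L}$.
   Context: For a class $K$ of algebras and a property $p$ of algebras, a lattice $\mathbb{L}$ forces $p$ in $K$ if every $\mathbf{A}\in K$ with $\mathrm{Con}(\mathbf{A})\cong\mathbb{L}$ has property $p$. $\mathrm{Con}(\mathbf{A})$ is the congruence lattice of $\mathbf{A}$, with least element $0_A$ and greatest element $1_A$. A variety is congruence modular if all its members have modular congruence lattices. Commutator: for congruences $\alpha,\beta$ of an algebra $\mathbf{A}$, $[\alpha,\beta]_{\mathbf{A}}$ is the intersection of all congruences $\delta$ of $\mathbf{A}$ such that for all $n\in\mathbb{N}$, all $(n+1)$-ary term functions $t$ of $\mathbf{A}$, all $(a,b)\in\alpha$ and all $(c_1,d_1),\dots,(c_n,d_n)\in\beta$: if $(t(a,c_1,\dots,c_n),t(a,d_1,\dots,d_n))\in\delta$ then $(t(b,c_1,\dots,c_n),t(b,d_1,\dots,d_n))\in\delta$. $\mathbf{A}$ is solvable if the derived series $\gamma_1=1_A$, $\gamma_{n+1}=[\gamma_n,\gamma_n]_{\mathbf{A}}$ satisfies $\gamma_m=0_A$ for some $m\in\mathbb{N}$. *)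

(* Defs.v *)
From HB Require Import structures.
From mathcomp Require Import all_boot all_order.
From mathcomp Require Import boolp.

Set Implicit Arguments.
Unset Strict Implicit.
Unset Printing Implicit Defensive.

Import Order.TTheory.
Local Open Scope order_scope.

Section Lattices.
Context {d d' : Order.disp_t} (L : latticeType d) (M : latticeType d').

Definition lattice_isomorphic := exists f : {lmorphism L -> M}, bijective f.

Definition lattice_homomorphic_image :=
  exists f : {lmorphism L -> M}, forall y, exists x, f x = y.

Definition modular_lattice :=
  forall x y z : L, x <= z -> x `|` (y `&` z) = (x `|` y) `&` z.

(* The cardinalities of the finite chains of [L] are bounded. *)
Definition finite_height :=
  exists n : nat, forall s : seq L, sorted <%O s -> (size s <= n)%N.

End Lattices.

Record signature := Signature { op :> Type; arity : op -> nat }.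

Record algebra (S : signature) := Algebra {
  carrier :> Type;
  interp : forall o : S, ('I_(arity o) -> carrier) -> carrier;
  carrier_inhabited : inhabited carrier }.

Section Terms.
Variable S : signature.

Inductive term (X : Type) :=
  | Var of X
  | App (o : S) of ('I_(arity o) -> term X).

Fixpoint eval (A : algebra S) (X : Type) (v : X -> A) (t : term X) : A :=
  match t with
  | Var x => v x
  | App o ts => interp (fun i => eval v (ts i))
  end.

End Terms.

Section Congruences.
Context {S : signature} (A : algebra S).

Record congruence := Congruence {
  cong_rel :> A -> A -> Prop;
  cong_refl : forall x, cong_rel x x;
  cong_sym : forall x y, cong_rel x y -> cong_rel y x;
  cong_trans : forall x y z, cong_rel x y -> cong_rel y z -> cong_rel x z;
  cong_interp : forall (o : S) (a b : 'I_(arity o) -> A),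
    (forall i, cong_rel (a i) (b i)) -> cong_rel (interp a) (interp b) }.

Lemma congruence_eqP (x y : congruence) :
  (forall a b, x a b <-> y a b) -> x = y.
Proof.
case: x => r r1 r2 r3 r4; case: y => s s1 s2 s3 s4 /= rs.
have {}rs : r = s by apply/predeq2P.
by case: s / rs s1 s2 s3 s4 => *; f_equal; apply: Prop_irrelevance.
Qed.

Program Definition cong_inf (P : congruence -> Prop) : congruence :=
  {| cong_rel x y := forall e, P e -> e x y |}.
Next Obligation. exact: cong_refl. Qed.
Next Obligation. by apply: cong_sym; apply: H. Qed.
Next Obligation. by apply: cong_trans (H _ H1) (H0 _ H1). Qed.
Next Obligation. by apply: cong_interp => i; apply: H. Qed.

Program Definition cong_bot : congruence := {| cong_rel x y := x = y |}.
Next Obligation. by congr interp; apply/funext. Qed.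

Program Definition cong_top : congruence := {| cong_rel _ _ := True |}.

Definition cong_le (x y : congruence) : bool :=
  `[< forall a b, x a b -> y a b >].

Program Definition cong_meet (x y : congruence) : congruence :=
  {| cong_rel a b := x a b /\ y a b |}.
Next Obligation. by split; apply: cong_refl. Qed.
Next Obligation. by split; apply: cong_sym. Qed.
Next Obligation. by split; [apply: cong_trans H H0 | apply: cong_trans H2 H1]. Qed.
Next Obligation. by split; apply: cong_interp => i; case: (H i). Qed.

Definition cong_join (x y : congruence) :=
  cong_inf (fun e => cong_le x e /\ cong_le y e).

HB.instance Definition _ := gen_eqMixin congruence.
HB.instance Definition _ := gen_choiceMixin congruence.

Fact cong_display : Order.disp_t. Proof. exact: Order.Disp tt tt. Qed.

Fact cong_le_refl : reflexive cong_le.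
Proof. by move=> x; apply/asboolP. Qed.

Fact cong_le_anti : antisymmetric cong_le.
Proof.
move=> x y /andP[/asboolP xy /asboolP yx].
by apply: congruence_eqP => a b; split; [exact: xy | exact: yx].
Qed.

Fact cong_le_trans : transitive cong_le.
Proof.
move=> y x z /asboolP xy /asboolP yz.
by apply/asboolP => a b /xy /yz.
Qed.

HB.instance Definition _ := Order.Le_isPOrder.Build cong_display congruence
  cong_le_refl cong_le_anti cong_le_trans.

Fact cong_meetP (x y z : congruence) :
  (x <= cong_meet y z) = (x <= y) && (x <= z).
Proof.
apply/asboolP/andP => [h|[/asboolP xy /asboolP xz] a b xab].
  by split; apply/asboolP => a b /h [].
by split; [exact: xy | exact: xz].
Qed.

Fact cong_joinP (x y z : congruence) :
  (cong_join x y <= z) = (x <= z) && (y <= z).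
Proof.
apply/asboolP/andP => [h|xyz a b]; last by apply.
by split; apply/asboolP => a b xab; apply: h => e [/asboolP xe /asboolP ye];
  [exact: xe | exact: ye].
Qed.

HB.instance Definition _ :=
  Order.POrder_MeetJoin_isLattice.Build cong_display congruence
    cong_meetP cong_joinP.

Fact cong_le0x (x : congruence) : cong_bot <= x.
Proof. by apply/asboolP => a _ <-; apply: cong_refl. Qed.

Fact cong_lex1 (x : congruence) : x <= cong_top.
Proof. exact/asboolP. Qed.

HB.instance Definition _ :=
  Order.hasBottom.Build cong_display congruence cong_le0x.
HB.instance Definition _ :=
  Order.hasTop.Build cong_display congruence cong_lex1.

(* The variables of an (n+1)-ary term are ['I_n.+1]; [scons a c] is the
   assignment (a, c_1, ..., c_n). *)
Definition scons (n : nat) (a : A) (c : 'I_n -> A) (i : 'I_n.+1) : A :=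
  oapp c a (unlift ord0 i).

Definition centralizes (x y e : congruence) :=
  forall (n : nat) (t : term S 'I_n.+1) (a b : A) (c d : 'I_n -> A),
    x a b -> (forall i, y (c i) (d i)) ->
    e (eval (scons a c) t) (eval (scons a d) t) ->
    e (eval (scons b c) t) (eval (scons b d) t).

Definition commutator (x y : congruence) : congruence :=
  cong_inf (centralizes x y).

(* [derived n] is the (n+1)-st term of the derived series. *)
Definition derived (n : nat) : congruence :=
  iter n (fun x => commutator x x) \top.

Definition solvable := exists n, derived n = \bot.

End Congruences.

Section Varieties.
Variable S : signature.

Definition is_hom (A B : algebra S) (f : A -> B) :=
  forall (o : S) (a : 'I_(arity o) -> A), f (interp a) = interp (f \o a).

Lemma prod_inhabited (I : Type) (A : I -> algebra S) :
  inhabited (forall i, A i).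
Proof.
have h i : exists x : A i, True by case: (carrier_inhabited (A i)) => x; exists x.
by exists => i; exact: sval (cid (h i)).
Qed.

Definition prod_algebra (I : Type) (A : I -> algebra S) : algebra S :=
  {| carrier := forall i, A i;
     interp o a := fun i => interp (fun k => a k i);
     carrier_inhabited := prod_inhabited A |}.

(* The second clause is closure under (isomorphic copies of) subalgebras. *)
Definition variety (V : algebra S -> Prop) :=
  [/\ forall (A B : algebra S) (f : A -> B), is_hom f ->
        (forall y, exists x, f x = y) -> V A -> V B,
      forall (A B : algebra S) (f : B -> A), is_hom f ->
        injective f -> V A -> V B &
      forall (I : Type) (A : I -> algebra S),
        (forall i, V (A i)) -> V (prod_algebra A)].

Definition congruence_modular (V : algebra S -> Prop) :=
  forall A, V A -> modular_lattice (congruence A).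

Definition generated_variety (A : algebra S) : algebra S -> Prop :=
  fun B => forall V, variety V -> V A -> V B.

End Varieties.

(* A class of algebras, or a property of algebras, of arbitrary signature. *)
Definition algebra_class := forall S : signature, algebra S -> Prop.

Definition generates_congruence_modular : algebra_class :=
  fun S A => congruence_modular (generated_variety A).

Definition forces d (L : latticeType d) (p K : algebra_class) :=
  forall (S : signature) (A : algebra S),
    K S A -> lattice_isomorphic (congruence A) L -> p S A.

(* Main.v *)
(* Suppose A is not solvable. By finite height the derived series reaches a
   perfect congruence g <> 0, and there is an m maximal subject to not (g <= m).
   In a congruence modular variety "x centralizes y modulo z" is symmetric in
   x, y and monotone in z, hence [x + m, y + m] <= xy + m. If xy <= m but
   x, y are not below m, then g <= x + m, y + m, so g = [g, g] <= m, which is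
   absurd: m is meet prime and x |-> not (x <= m) maps Con(A) onto the two
   element lattice.
   Conversely, given a map of Con(A) onto the two element lattice, expand A by
   a binary operation that preserves all congruences and acts on some {a, b} as
   a meet; then (a, b) lies in every term of the derived series, while the
   congruence lattice is unchanged and modularity of the variety persists. *)
Require Import Defs.
From mathcomp Require Import all_boot all_order.
From HB Require Import structures.
From mathcomp Require Import boolp.
From Stdlib Require Import Relation_Operators.

Set Implicit Arguments.
Unset Strict Implicit.
Unset Printing Implicit Defensive.

Import Order.TTheory.
Local Open Scope order_scope.

(** * Finite height and lattice morphisms *)

Section FiniteHeight.
Context {d : Order.disp_t} {L : latticeType d}.

(** Without a minimal element, prepending ever smaller elements to [x] produces a chain of [n + 1]
    elements, one more than the bound allows. *)
Lemma finite_height_minimal : finite_height L ->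
  forall P : L -> Prop, (exists x, P x) ->
  exists2 m, P m & forall y, P y -> ~ y < m.
Proof.
move=> [n hn] P [x Px]; apply: contrapT => nomin.
have next y : P y -> exists2 z, P z & z < y.
  move=> Py; apply: contrapT => noz; apply: nomin; exists y => // z Pz zy.
  by apply: noz; exists z.
have [y [s [_ ys sn]]] : exists y s, [/\ P y, sorted <%O (y :: s) & size s = n].
  elim: n {hn} => [|n [y [s [Py ys <-]]]]; first by exists x, [::].
  by have [z Pz zy] := next y Py; exists z, (y :: s); rewrite /= zy.
by have := hn _ ys; rewrite /= sn ltnn.
Qed.

Lemma finite_height_dual : finite_height L -> finite_height L^d.
Proof.
move=> [n hn]; exists n => s ss; rewrite -size_rev; apply: (hn (rev s)).
by rewrite rev_sorted.
Qed.

End FiniteHeight.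

Lemma finite_height_maximal d (L : latticeType d) : finite_height L ->
  forall P : L -> Prop, (exists x, P x) ->
  exists2 m, P m & forall y, P y -> ~ m < y.
Proof. by move=> /finite_height_dual; exact: finite_height_minimal. Qed.

Section BuildMorphism.
Context {d d' : Order.disp_t} {L : latticeType d} {M : latticeType d'}.
Variables (f : L -> M).
Hypothesis fI : {morph f : x y / x `&` y}.
Hypothesis fU : {morph f : x y / x `|` y}.

Let f_homo : {homo f : x y / x <= y}.
Proof. by move=> x y /meet_idPl xy; rewrite -xy fI leIr. Qed.

#[local] HB.instance Definition _ := Order.isOrderMorphism.Build d L d' M f f_homo.
#[local] HB.instance Definition _ := Order.isLatticeMorphism.Build d L d' M f fI fU.

Lemma lmorphism_of_morph : exists g : {lmorphism L -> M}, g =1 f.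
Proof. by exists f. Qed.

End BuildMorphism.

Lemma lattice_isomorphic_sym d d' (L : latticeType d) (M : latticeType d') :
  lattice_isomorphic L M -> lattice_isomorphic M L.
Proof.
move=> [f [g fK gK]].
have [h hg] : exists h : {lmorphism M -> L}, h =1 g.
  apply: lmorphism_of_morph => u v; apply: (can_inj fK).
    by rewrite omorphI /= !gK.
  by rewrite omorphU /= !gK.
by exists h, f => x; rewrite hg.
Qed.

Lemma finite_height_isomorphic d d' (L : latticeType d) (M : latticeType d') :
  lattice_isomorphic L M -> finite_height M -> finite_height L.
Proof.
move=> [f [g fK _]] [n hn]; exists n => s ss; rewrite -(size_map f); apply: hn.
apply: homo_sorted ss => x y xy.
by rewrite lt_neqAle (inj_eq (can_inj fK)) (lt_eqF xy) omorph_le // ltW.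
Qed.

Lemma homomorphic_image_isomorphic d d' d'' (L : latticeType d)
    (M : latticeType d') (N : latticeType d'') :
  lattice_isomorphic L M -> lattice_homomorphic_image L N ->
  lattice_homomorphic_image M N.
Proof.
move=> /lattice_isomorphic_sym[g [g' gK g'K]] [f fsurj].
have [h hE] : exists h : {lmorphism M -> N}, h =1 f \o g.
  by apply: lmorphism_of_morph => u v /=; rewrite ?omorphI ?omorphU.
by exists h => y; have [x <-] := fsurj y; exists (g' x); rewrite hE /= g'K.
Qed.

(** * Joins and centralizers of congruences *)

Definition update n T (c : 'I_n -> T) (i : 'I_n) (x : T) (j : 'I_n) : T :=
  if j == i then x else c j.

(** Passes from [a] to [b] through the tuples [c k] whose first [k] entries come from [b] and the
    others from [a]. *)
Lemma coordinatewise n T (P : ('I_n -> T) -> Prop) (a b : 'I_n -> T) :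
  (forall c i, (forall j, c j = a j \/ c j = b j) ->
     P (update c i (a i)) -> P (update c i (b i))) ->
  P a -> P b.
Proof.
move=> step Pa.
pose c k (j : 'I_n) := if (j < k)%N then b j else a j.
have Pc k : (k <= n)%N -> P (c k).
  elim: k => [_|k IHk kn]; first by rewrite (_ : c 0 = a) //; apply/funext.
  have := step (c k) (Ordinal kn) _ _.
  have -> : update (c k) (Ordinal kn) (b (Ordinal kn)) = c k.+1.
    apply/funext => j; rewrite /update /c ltnS [in RHS]leq_eqVlt -val_eqE /=.
    by case: eqP => // jk; congr b; apply: val_inj.
  have -> : update (c k) (Ordinal kn) (a (Ordinal kn)) = c k.
    apply/funext => j; rewrite /update /c -val_eqE /=.
    by case: eqP => // jk; rewrite jk ltnn; congr a; apply: val_inj.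
  by apply; [move=> j; rewrite /c; case: ifP; [right|left] | exact/IHk/ltnW].
rewrite (_ : b = c n); first exact: Pc.
by apply/funext => j; rewrite /c ltn_ord.
Qed.

Section CongruenceLattice.
Context {S : signature} {A : algebra S}.
Implicit Types x y z : congruence A.

Lemma cong_leP x y : reflect (forall a b, x a b -> y a b) (x <= y).
Proof. exact: asboolP. Qed.

Lemma clos_interp (R : A -> A -> Prop) :
  (forall (o : S) (c : 'I_(arity o) -> A) i u v,
    R u v -> R (interp (update c i u)) (interp (update c i v))) ->
  forall (o : S) (a b : 'I_(arity o) -> A),
  (forall i, clos_refl_trans A R (a i) (b i)) ->
  clos_refl_trans A R (interp a) (interp b).
Proof.
move=> Rtr o a b ab.
apply: (@coordinatewise _ _ (fun c => clos_refl_trans A R (interp a) (interp c))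
  a b _ (rt_refl _ _ _)) => c i _ aci; apply: rt_trans aci _.
elim: (ab i) => [u v uv|u|u v w _ uv _ vw].
- by apply: rt_step; apply: Rtr.
- exact: rt_refl.
- exact: rt_trans uv vw.
Qed.

Lemma cong_update x (o : S) (c : 'I_(arity o) -> A) i u v :
  x u v -> x (interp (update c i u)) (interp (update c i v)).
Proof.
move=> uv; apply: cong_interp => j; rewrite /update; case: (j == i) => //.
exact: cong_refl.
Qed.

Lemma cong_joinE x y a b :
  (x `|` y) a b <-> clos_refl_trans A (fun u v => x u v \/ y u v) a b.
Proof.
rewrite -[x `|` y]/(cong_join x y).
split=> [|ab e [/cong_leP xe /cong_leP ye]]; last first.
  elim: ab => [u v [/xe|/ye]|u|u v w _ uv _ vw] //; first exact: cong_refl.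
  exact: cong_trans uv vw.
set R := clos_refl_trans A _; move=> xyab.
have Rsym u v : R u v -> R v u.
  elim=> [{}u {}v [uv|uv]|{}u|{}u {}v w _ vu _ wv].
  - by apply: rt_step; left; apply: cong_sym.
  - by apply: rt_step; right; apply: cong_sym.
  - exact: rt_refl.
  - exact: rt_trans wv vu.
have Rinterp (o : S) (c d : 'I_(arity o) -> A) :
    (forall i, R (c i) (d i)) -> R (interp c) (interp d).
  by apply: clos_interp => o' c' i u v [uv|uv]; [left|right]; apply: cong_update.
apply: (xyab (Congruence (@rt_refl _ _) Rsym (@rt_trans _ _) Rinterp)).
by split; apply/cong_leP => u v uv; apply: rt_step; [left|right].
Qed.

(** Only one inclusion has content, since the other holds in every lattice. This form mentions just
    the underlying relations, so it can be carried over to algebras of another signature. *)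
Lemma cong_modularP : modular_lattice (congruence A) <->
  forall x y z, x <= z -> forall a b, z a b ->
    clos_refl_trans A (fun u v => x u v \/ y u v) a b ->
    clos_refl_trans A (fun u v => x u v \/ y u v /\ z u v) a b.
Proof.
split=> [mod x y z xz a b zab xyab|h x y z xz].
  have : ((x `|` y) `&` z) a b by split=> //; apply/cong_joinE.
  by rewrite -mod // => /cong_joinE.
apply: congruence_eqP => a b; split=> [|[/cong_joinE xyab zab]]; last first.
  by apply/cong_joinE; apply: h.
have le : x `|` (y `&` z) <= (x `|` y) `&` z.
  by rewrite leUx !lexI leUl xz leIr (le_trans (leIl _ _) (leUr _ _)).
exact/cong_leP.
Qed.

(* The pairs of unary polynomials [t(-, c)], [t(-, d)] with [c], [d] congruent
   modulo [y]. *)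
Inductive twin y : (A -> A) -> (A -> A) -> Prop :=
  | twin_id : twin y id id
  | twin_const c d : y c d -> twin y (fun=> c) (fun=> d)
  | twin_op (o : S) (f g : 'I_(arity o) -> A -> A) :
      (forall i, twin y (f i) (g i)) ->
      twin y (fun a => interp (f^~ a)) (fun a => interp (g^~ a)).

Lemma twin_comp y f g h k : twin y f g -> twin y h k -> twin y (f \o h) (g \o k).
Proof.
move=> fg hk; elim: fg => [|c d cd|o f' g' _ IH] //; first exact: twin_const.
exact: (twin_op IH).
Qed.

Lemma twin_update y (o : S) (c d : 'I_(arity o) -> A) i :
  (forall j, y (c j) (d j)) ->
  twin y (fun a => interp (update c i a)) (fun a => interp (update d i a)).
Proof.
move=> cd; apply: (@twin_op _ o (fun j a => update c i a j)
  (fun j a => update d i a j)) => j; rewrite /update.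
by case: (j == i); [exact: twin_id|exact: twin_const].
Qed.

(** The relation of the largest congruence that centralizes [y] modulo [z]. Twins are closed under
    composition, which gives compatibility with the operations. *)
Definition centralizer_rel y z a b :=
  forall f g, twin y f g -> z (f a) (g a) <-> z (f b) (g b).

Lemma centralizer_interp y z (o : S) (a b : 'I_(arity o) -> A) :
  (forall i, centralizer_rel y z (a i) (b i)) ->
  centralizer_rel y z (interp a) (interp b).
Proof.
move=> ab f g fg.
apply: (@coordinatewise _ _
  (fun c => z (f (interp a)) (g (interp a)) <-> z (f (interp c)) (g (interp c)))
  a b) => // c i _ ->.
by apply: (ab i _ _ (twin_comp fg (twin_update i _))) => j; apply: cong_refl.
Qed.

Program Definition centralizer y z : congruence A :=
  {| cong_rel := centralizer_rel y z |}.
Next Obligation. by []. Qed.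
Next Obligation. by move=> f g fg; apply: iff_sym; apply: H. Qed.
Next Obligation. by move=> f g fg; apply: iff_trans (H _ _ fg) (H0 _ _ fg). Qed.
Next Obligation. exact: centralizer_interp. Qed.

Lemma centralizes_centralizer x y z : x <= centralizer y z -> centralizes x y z.
Proof.
move=> /cong_leP xyz n t a b c d /xyz ab cd.
have tw : twin y (fun a => eval (scons a c) t) (fun a => eval (scons a d) t).
  elim: t => [i|o ts IH]; last exact: twin_op IH.
  rewrite /= /scons; case: (unlift ord0 i) => [j|]; last exact: twin_id.
  exact: twin_const.
by rewrite -(ab _ _ tw).
Qed.

(* [matrices x y p q r s] holds for the subalgebra of 2x2 matrices with rows
   [(p, q)] and [(r, s)], generated by those with constant rows and [x]-related
   columns and those with constant columns and [y]-related rows. *)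
Inductive matrices x y : A -> A -> A -> A -> Prop :=
  | matrices_l a b : x a b -> matrices x y a a b b
  | matrices_r c d : y c d -> matrices x y c d c d
  | matrices_op (o : S) (p q r s : 'I_(arity o) -> A) :
      (forall i, matrices x y (p i) (q i) (r i) (s i)) ->
      matrices x y (interp p) (interp q) (interp r) (interp s).

Lemma matrices_trans x y p q r s : matrices x y p q r s -> matrices y x p r q s.
Proof.
by elim=> *; [exact: matrices_r|exact: matrices_l|exact: matrices_op].
Qed.

Lemma matrices_flip x y p q r s : matrices x y p q r s -> matrices x y r s p q.
Proof.
elim=> *; [|exact: matrices_r|exact: matrices_op].
by apply: matrices_l; apply: cong_sym.
Qed.

Lemma matrices_row x y p q r s : matrices x y p q r s -> y p q /\ y r s.
Proof.
elim=> [a b _|c d cd|o p' q' r' s' _ IH] //; first by split; exact: cong_refl.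
by split; apply: cong_interp => i; case: (IH i).
Qed.

Lemma matrices_col x y p q r s : matrices x y p q r s -> x p r /\ x q s.
Proof. by move=> /matrices_trans/matrices_row. Qed.

Lemma matrices_eval x y (X : Type) (t : term S X) (p q r s : X -> A) :
  (forall i, matrices x y (p i) (q i) (r i) (s i)) ->
  matrices x y (eval p t) (eval q t) (eval r t) (eval s t).
Proof. by move=> m; elim: t => [i|o ts IH] /=; [exact: m|exact: matrices_op]. Qed.

(** Twins evaluated at an [x]-related pair form a matrix, and flipping it gives the reverse
    implication. Conversely, induct on the matrix for all twins at once: the rows of the arguments
    are [y]-related, so all coordinates but one can be absorbed into the twin. *)
Lemma le_centralizerP x y z : x <= centralizer y z <->
  forall p q r s, matrices x y p q r s -> z p q -> z r s.
Proof.
split=> [/cong_leP xyz p q r s m|h]; last first.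
  apply/cong_leP => a b ab f g fg.
  have m : matrices x y (f a) (g a) (f b) (g b).
    by elim: fg => [|c d cd|o f' g' _ IH];
      [exact: matrices_l|exact: matrices_r|exact: matrices_op].
  by split; apply: h => //; apply: matrices_flip.
suff: forall f g, twin y f g -> z (f p) (g q) -> z (f r) (g s).
  by move=> /(_ _ _ (twin_id y)).
elim: m => [a b /xyz ab|//|o p' q' r' s' m IH] f g fg; first by rewrite (ab _ _ fg).
apply: (@coordinatewise _ _
  (fun c => z (f (interp (fun i => (c i).1))) (g (interp (fun i => (c i).2))))
  (fun i => (p' i, q' i)) (fun i => (r' i, s' i))) => c i cpr.
have updE (b : A * A) : (fun j => (update c i b j).1) = update (fst \o c) i b.1
    /\ (fun j => (update c i b j).2) = update (snd \o c) i b.2.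
  by split; apply/funext => j; rewrite /update; case: (j == i).
rewrite !(updE _).1 !(updE _).2 /=.
apply: (IH i _ _ (twin_comp fg (twin_update i _))) => j /=.
by have [? ?] := matrices_row (m j); case: (cpr j) => ->.
Qed.

(** The centralizer form of the inclusion of the commutator in the meet. *)
Lemma le_centralizer_meet x y : x <= centralizer y (x `&` y).
Proof.
apply/le_centralizerP => p q r s m [xpq _].
have [xpr xqs] := matrices_col m; have [_ yrs] := matrices_row m.
by split=> //; apply: cong_trans xqs; apply: cong_trans xpq; apply: cong_sym.
Qed.

Lemma le_centralizer_self x y : x <= centralizer y x.
Proof.
apply/le_centralizerP => p q r s m xpq; have [xpr xqs] := matrices_col m.
by apply: cong_trans xqs; apply: cong_trans xpq; apply: cong_sym.
Qed.

End CongruenceLattice.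

(** * Day's terms and symmetry of the centralizer relation *)

Lemma generated_varietyP S (A : algebra S) : variety (generated_variety A).
Proof.
split=> [B C f fh fs BA V vV VA|B C f fh fi BA V vV VA|I B BA V vV VA];
  have [vH vS vP] := vV.
- exact: vH fh fs (BA V vV VA).
- exact: vS fh fi (BA V vV VA).
- by apply: vP => i; apply: BA.
Qed.

Lemma generated_variety_self S (A : algebra S) : generated_variety A A.
Proof. by []. Qed.

Section TermOperations.
Context {S : signature} (A : algebra S).

Lemma cong_eval (z : congruence A) (X : Type) (t : term S X) (v w : X -> A) :
  (forall i, z (v i) (w i)) -> z (eval v t) (eval w t).
Proof. by move=> vw; elim: t => [i|o ts IH] /=; [exact: vw|exact: cong_interp]. Qed.

Notation quad := (bool * bool)%type.

Definition val4 (x y v u : A) (i : quad) : A :=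
  match i with
  | (false, false) => x
  | (false, true) => y
  | (true, false) => v
  | (true, true) => u
  end.

Definition is_term_op (h : (quad -> A) -> A) :=
  exists t : term S quad, h = fun v => eval v t.

Lemma is_term_op_interp (o : S) (h : 'I_(arity o) -> (quad -> A) -> A) :
  (forall i, is_term_op (h i)) -> is_term_op (fun v => interp (h^~ v)).
Proof.
move=> /choice[ts hE]; exists (App ts); apply/funext => v /=.
by congr interp; apply/funext => i; rewrite hE.
Qed.

Definition term_var (i : quad) : sig is_term_op :=
  exist _ (@^~ i) (ex_intro _ (Var S i) erefl).

(* The free algebra on four generators in the variety generated by [A]. *)
Definition free4 : algebra S :=
  {| carrier := sig is_term_op;
     interp o a := exist is_term_op (fun v => interp (fun i => sval (a i) v))
       (is_term_op_interp (fun i => svalP (a i)));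
     carrier_inhabited := inhabits (term_var (false, false)) |}.

Lemma free4_generated : generated_variety A free4.
Proof.
have [_ sub prod] := generated_varietyP A.
apply: (sub (prod_algebra (fun _ : quad -> A => A)) free4 sval).
- by [].
- move=> [h ht] [k kt] /= hk; case: _ / hk kt => kt.
  by congr exist; apply: Prop_irrelevance.
- by apply: prod => _; apply: generated_variety_self.
Qed.

Program Definition agree_on (W : (quad -> A) -> Prop) : congruence free4 :=
  {| cong_rel h k := forall v, W v -> sval h v = sval k v |}.
Next Obligation. by rewrite H. Qed.
Next Obligation. by rewrite H ?H0. Qed.
Next Obligation. by congr interp; apply/funext => i; apply: H. Qed.

(* The terms [t] with [t(x, y, y, x) = x] play the role of Day's terms: in the
   free algebra with generators x, y, v, u, the modular law puts (x, u) into the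
   join of the kernels of the substitution y = v and of its two companions
   below, and every element of the connecting chain is such a term. *)
Lemma day (z : congruence A) (a b c d : A) :
  modular_lattice (congruence free4) -> z b d ->
  (forall t : term S quad,
     (forall x y, eval (val4 x y y x) t = x) ->
     z (eval (val4 a a c c) t) (eval (val4 a b d c) t)) ->
  z a c.
Proof.
move=> /cong_modularP mod bd hz.
pose theta := agree_on (fun w => exists x y u, w = val4 x y y u).
pose phi := agree_on (fun w => exists x u, w = val4 x x u u).
pose psi := agree_on (fun w => exists x y, w = val4 x y y x).
have theta_psi : theta <= psi.
  by apply/cong_leP => h k hk _ [x [y ->]]; apply: hk; exists x, y, x.
pose X := term_var (false, false); pose Y := term_var (false, true).
pose V := term_var (true, false); pose U := term_var (true, true).
have psiXU : psi X U by move=> _ [x [y ->]].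
have XU : clos_refl_trans free4 (fun u v => theta u v \/ phi u v) X U.
  apply: (@rt_trans _ _ _ Y); first by apply: rt_step; right=> _ [x [u ->]].
  apply: (@rt_trans _ _ _ V); first by apply: rt_step; left=> _ [x [y [u ->]]].
  by apply: rt_step; right=> _ [x [u ->]].
have {XU} := mod theta phi psi theta_psi X U psiXU XU.
have op_z (h : free4) v w : (forall i, z (v i) (w i)) -> z (sval h v) (sval h w).
  by case: h => /= _ [t ->] vw; apply: cong_eval.
have phi_z (h : free4) : psi X h ->
    z (sval h (val4 a a c c)) (sval h (val4 a b d c)).
  move=> Xh; have [t hE] := svalP h; rewrite hE; apply: hz => x y.
  transitivity (sval h (val4 x y y x)); first by rewrite hE.
  by rewrite -Xh //; exists x, y.
have theta_z (h : free4) : z (sval h (val4 a b b c)) (sval h (val4 a b d c)).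
  by apply: op_z => -[[] []] //=; exact: cong_refl.
(* Along the chain the values at [(a, b, d, c)] stay [z]-related: a [theta] link is compared at
   [(a, b, b, c)], a [phi] link at [(a, a, c, c)]. The end values are [a] and [c]. *)
suff chain h k : clos_refl_trans free4
    (fun u v => theta u v \/ phi u v /\ psi u v) h k ->
    psi h k /\ (psi X h -> z (sval h (val4 a b d c)) (sval k (val4 a b d c))).
  by move=> /chain[_]; apply; apply: cong_refl.
elim=> [{}h {}k [hk|[hk hk']]|{}h|{}h k' {}k _ [hk' IH] _ [k'k IH']].
- split=> [|_]; first exact: (cong_leP _ _ theta_psi).
  apply: cong_trans (theta_z k); rewrite -hk; last by exists a, b, c.
  exact/cong_sym.
- split=> // Xh; apply: cong_trans (phi_z k (cong_trans Xh hk')).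
  by rewrite -hk; [exact/cong_sym/phi_z|exists a, c].
- by split=> [|_]; apply: cong_refl.
- split=> [|Xh]; first exact: cong_trans k'k.
  by apply: cong_trans (IH Xh) (IH' (cong_trans Xh hk')).
Qed.

Hypothesis modA : congruence_modular (generated_variety A).

(** In [day] the pair [(p, q)] need only lie in the larger [z'], while the condition on terms is met
    already in [z]; so symmetry and monotonicity come together. *)
Lemma centralizer_swap (x y z z' : congruence A) :
  y <= centralizer x z -> z <= z' -> x <= centralizer y z'.
Proof.
move=> /le_centralizerP yxz /cong_leP zz'; apply/le_centralizerP => p q r s m pq.
have [[xpr xqs] [ypq yrs]] := (matrices_col m, matrices_row m).
apply: (day (modA free4_generated) pq) => t tid; apply: zz'.
(* By [tid] both entries of the first row equal [r], so [yxz] puts the second row into [z]. *)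
have : matrices y x (eval (val4 r r r r) t) (eval (val4 r p p r) t)
    (eval (val4 r r s s) t) (eval (val4 r p q s) t).
  apply: matrices_eval => -[[] []] /=.
  - exact: matrices_l.
  - exact/matrices_trans/matrices_flip.
  - by apply: matrices_r; apply: cong_sym.
  - by apply: matrices_l; apply: cong_refl.
by move=> /yxz; apply; rewrite !tid; apply: cong_refl.
Qed.

(* With [x `&` y <= m], [x] centralizes [y] modulo [m], and [m] centralizes
   everything modulo itself; symmetry of the centralizer relation combines
   these facts. *)
Lemma perfect_meet_prime (g m x y : congruence A) :
  commutator g g = g -> ~~ (g <= m) -> (forall e, m < e -> g <= e) ->
  x `&` y <= m -> (x <= m) || (y <= m).
Proof.
move=> gg /negP ngm gm xym; apply/negPn/negP; rewrite negb_or => /andP[xm ym].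
have gJ e : ~~ (e <= m) -> g <= e `|` m.
  by move=> em; apply: gm; rewrite lt_neqAle leUr andbT eq_sym eq_joinr.
have xJm_y : x `|` m <= centralizer y m.
  rewrite leUx le_centralizer_self andbT.
  by apply: centralizer_swap (le_centralizer_meet y x) _; rewrite meetC.
have yJm_xJm : y `|` m <= centralizer (x `|` m) m.
  by rewrite leUx le_centralizer_self andbT; apply: centralizer_swap xJm_y _.
(* As [g] lies below both joins, it centralizes itself modulo [m]. *)
apply: ngm; rewrite -gg; apply/cong_leP => u v; apply.
move=> n t a b c d /(cong_leP _ _ (gJ _ ym)) ab gcd.
apply: (centralizes_centralizer yJm_xJm) ab _ => i.
exact: (cong_leP _ _ (gJ _ xm)).
Qed.

End TermOperations.

(** * From nonsolvability to a two element image *)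

Lemma bool_image_of_prime d (L : latticeType d) (g m : L) :
  ~~ (g <= m) -> (forall x y, x `&` y <= m -> (x <= m) || (y <= m)) ->
  lattice_homomorphic_image L bool.
Proof.
move=> gm prime.
have [f fE] : exists f : {lmorphism L -> bool}, f =1 (fun x => ~~ (x <= m)).
  apply: lmorphism_of_morph => x y; last by rewrite leUx negb_and.
  apply/negb_inj; rewrite negbK negb_and !negbK; apply/idP/orP => [/prime/orP //|].
  by case; apply: le_trans; [exact: leIl|exact: leIr].
exists f => -[]; [exists g|exists m]; rewrite fE //.
by rewrite lexx.
Qed.

Lemma not_solvable_bool_image S (A : algebra S) :
  finite_height (congruence A) -> congruence_modular (generated_variety A) ->
  ~ solvable A -> lattice_homomorphic_image (congruence A) bool.
Proof.
move=> fh modA nsol.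
have [g [n ng] gmin] := finite_height_minimal fh
  (ex_intro (fun x => exists n, x = derived A n) _ (ex_intro _ 0%N erefl)).
(* The commutator of [g] with itself is the next term of the series and lies below [g], so
   minimality makes them equal. *)
have gg : commutator g g = g.
  apply/eqP/negPn/negP => neq; apply: (gmin (commutator g g)).
    by exists n.+1; rewrite ng.
  rewrite lt_neqAle neq; apply/cong_leP => a b; apply.
  exact: centralizes_centralizer (le_centralizer_self g g).
have g0 : ~~ (g <= \bot).
  by rewrite lex0; apply/eqP => g0; apply: nsol; exists n; rewrite -ng.
have [m gm mmax] := finite_height_maximal fh (ex_intro (fun m => ~~ (g <= m)) _ g0).
apply: (@bool_image_of_prime _ _ g m gm) => x y.
apply: (perfect_meet_prime modA gg gm) => e me.
by apply/negPn/negP => /mmax.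
Qed.

(** * Isomorphisms and expansion by a binary operation *)

Lemma order_isomorphic_lattice d d' (L : latticeType d) (M : latticeType d')
    (f : L -> M) (g : M -> L) :
  cancel f g -> cancel g f -> {mono f : x y / x <= y} -> lattice_isomorphic L M.
Proof.
move=> fK gK fmono.
have [h hf] : exists h : {lmorphism L -> M}, h =1 f.
  apply: lmorphism_of_morph => x y; apply: le_anti.
    by rewrite lexI !fmono leIl leIr -[X in X <= f _]gK fmono lexI -!fmono gK
      leIl leIr.
  by rewrite leUx !fmono leUl leUr -[X in f _ <= X]gK fmono leUx -!fmono gK
    leUl leUr.
by exists h, g => x; rewrite hf.
Qed.

Lemma lattice_isomorphic_trans d d' d'' (L : latticeType d) (M : latticeType d')
    (N : latticeType d'') :
  lattice_isomorphic L M -> lattice_isomorphic M N -> lattice_isomorphic L N.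
Proof.
move=> [f [f' fK f'K]] [g [g' gK g'K]].
have [h hE] : exists h : {lmorphism L -> N}, h =1 g \o f.
  by apply: lmorphism_of_morph => u v /=; rewrite ?omorphI ?omorphU.
by exists h, (f' \o g') => x; rewrite hE /= ?gK ?fK ?f'K ?g'K.
Qed.

Section BinaryExpansion.
Context {S : signature}.

Definition expansion_signature : signature :=
  @Signature (option S) (oapp (@arity S) 2%N).

Section Reduct.
Variable A : algebra expansion_signature.

Definition reduct : algebra S :=
  {| carrier := A;
     interp o a := @interp expansion_signature A (Some o) a;
     carrier_inhabited := carrier_inhabited A |}.

Program Definition reduct_cong (x : congruence A) : congruence reduct :=
  {| cong_rel := x |}.
Next Obligation. exact: cong_refl. Qed.
Next Obligation. exact: cong_sym. Qed.
Next Obligation. exact: cong_trans H H0. Qed.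
Next Obligation. exact: (@cong_interp _ _ x (Some o)). Qed.

Lemma modular_reduct :
  modular_lattice (congruence reduct) -> modular_lattice (congruence A).
Proof.
move=> /cong_modularP mod; apply/cong_modularP => x y z /cong_leP xz.
by apply: (mod (reduct_cong x) (reduct_cong y) (reduct_cong z)); apply/cong_leP.
Qed.

End Reduct.

Lemma variety_reduct (V : algebra S -> Prop) : variety V -> variety (V \o reduct).
Proof.
move=> [Vhom Vsub Vprod]; split=> [A B f fh fs|A B f fh fi|I A VA] /=.
- by apply: (Vhom (reduct A) (reduct B) f _ fs) => o a; apply: (fh (Some o)).
- by apply: (Vsub (reduct A) (reduct B) f _ fi) => o a; apply: (fh (Some o)).
(* The two algebras have the same operations but possibly different proofs of inhabitation, so the
   identity serves as a surjective homomorphism. *)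
- apply: (Vhom (prod_algebra (fun i => reduct (A i))) (reduct (prod_algebra A))
    id).
  + by [].
  + by move=> h; exists h.
  + exact: Vprod.
Qed.

Variables (A : algebra S) (g : A -> A -> A).

Definition expansion_interp (o : option S) :
    ('I_(oapp (@arity S) 2%N o) -> A) -> A :=
  match o with
  | Some o => @interp S A o
  | None => fun a => g (a ord0) (a ord_max)
  end.

Definition expansion : algebra expansion_signature :=
  {| carrier := A;
     interp := expansion_interp : forall o : expansion_signature, _;
     carrier_inhabited := carrier_inhabited A |}.

(** The algebras whose reduct lies in [V] form a variety containing the expansion, and they inherit
    modularity from their reducts. *)
Lemma modular_expansion (V : algebra S -> Prop) :
  variety V -> congruence_modular V -> V A ->
  congruence_modular (generated_variety expansion).
Proof.
move=> vV mV VA B /(_ _ (variety_reduct vV)) VB; apply: modular_reduct.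
apply: mV; apply: VB; have [Vhom _ _] := vV.
by apply: (Vhom A (reduct expansion) id) => // y; exists y.
Qed.

Hypothesis g_cong : forall (x : congruence A) a b c d,
  x a b -> x c d -> x (g a c) (g b d).

Program Definition expansion_cong (x : congruence A) : congruence expansion :=
  {| cong_rel := x |}.
Next Obligation. exact: cong_refl. Qed.
Next Obligation. exact: cong_sym. Qed.
Next Obligation. exact: cong_trans H H0. Qed.
Next Obligation. by case: o a b H => [o|] a b H; [exact: cong_interp|exact: g_cong]. Qed.

Program Definition base_cong (x : congruence expansion) : congruence A :=
  {| cong_rel := x |}.
Next Obligation. exact: cong_refl. Qed.
Next Obligation. exact: cong_sym. Qed.
Next Obligation. exact: cong_trans H H0. Qed.
Next Obligation. exact: (@cong_interp _ _ x (Some o)). Qed.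

Lemma expansion_isomorphic :
  lattice_isomorphic (congruence expansion) (congruence A).
Proof.
apply: (@order_isomorphic_lattice _ _ _ _ base_cong expansion_cong) => [x|x|x y].
- exact: congruence_eqP.
- exact: congruence_eqP.
- by apply/cong_leP/cong_leP.
Qed.

(** Apply the term condition to [g]: the values at [(a, a)] and [(a, b)] coincide, so those at
    [(b, a)] and [(b, b)], namely [a] and [b], are related by every admissible [e]. *)
Lemma expansion_not_solvable a b :
  a <> b -> g a a = a -> g a b = a -> g b a = a -> g b b = b -> ~ solvable expansion.
Proof.
move=> nab gaa gab gba gbb [n der0]; apply: nab.
suff : derived expansion n a b by rewrite der0.
elim: n {der0} => // n IH.
rewrite [derived _ _]/(commutator (derived expansion n) _) => e cent.
pose t : term expansion_signature 'I_2 := @App expansion_signature _ None (@Var _ _).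
have ev u v : eval (A := expansion) (scons u (fun _ : 'I_1 => v)) t = g u v.
  rewrite /= /scons unlift_none /=; congr g.
  by rewrite (_ : ord_max = lift ord0 ord0) ?liftK //; apply: val_inj.
have := cent 1%N t a b (fun=> a) (fun=> b) IH (fun=> IH).
by rewrite !ev gaa gab gba gbb; apply; apply: cong_refl.
Qed.

End BinaryExpansion.

(* A homomorphism onto the two element lattice splits the congruences into those
   below [m] and those above [n]. For [(a, b)] in [n] but not in [m], an operation
   with values in [{a, b}] that factors modulo [m] preserves all congruences. *)
Lemma bool_image_meet_operation S (A : algebra S) :
  finite_height (congruence A) -> lattice_homomorphic_image (congruence A) bool ->
  exists (g : A -> A -> A) (a b : A),
    [/\ forall (x : congruence A) u v u' v', x u v -> x u' v' -> x (g u u') (g v v'),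
        a <> b, g a a = a, g a b = a & g b a = a /\ g b b = b].
Proof.
move=> fh [f fsurj].
have [m fm mmax] := finite_height_maximal fh (fsurj false).
have [n fn nmin] := finite_height_minimal fh (fsurj true).
have below x : f x = false -> x <= m.
  move=> fx; apply/negPn/negP => xm; apply: (mmax (x `|` m)).
    by rewrite omorphU /= fx fm.
  by rewrite lt_neqAle leUr andbT eq_sym eq_joinr.
have above x : f x = true -> n <= x.
  move=> fx; apply/negPn/negP => nx; apply: (nmin (n `&` x)).
    by rewrite omorphI /= fx fn.
  by rewrite lt_neqAle leIl andbT eq_meetl.
have [a [b [nab mab]]] : exists a b, n a b /\ ~ m a b.
  apply: contrapT => no; have : n <= m.
    apply/cong_leP => a b nab; apply: contrapT => mab; apply: no.
    by exists a, b.
  by move=> /(omorph_le f) /=; rewrite fm fn.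
have mba : ~ m b a by move=> /cong_sym.
(* Since [a] is outside the [m]-block of [b], this is the meet on [{a, b}] with [a] at the
   bottom. *)
pose g u v := if `[< m b u /\ m b v >] then b else a.
have gE u v : (m b u /\ m b v -> g u v = b) /\ (~ (m b u /\ m b v) -> g u v = a).
  by split=> h; rewrite /g; case: asboolP.
exists g, a, b; split.
- move=> x u v u' v' xuv xuv'.
  case fx: (f x).
    have xab := cong_leP _ _ (above _ fx) _ _ nab.
    by rewrite /g; case: asboolP => _; case: asboolP => _ //;
      [exact: cong_refl|exact: cong_sym|exact: cong_refl].
  have /cong_leP xm := below _ fx.
  have muv w w' : x w w' -> m b w <-> m b w'.
    move=> /xm ww'; split=> bw; first exact: cong_trans bw ww'.
    exact: cong_trans bw (cong_sym ww').
  rewrite /g (_ : `[< _ >] = `[< m b v /\ m b v' >]); first exact: cong_refl.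
  by apply: asbool_equiv_eq; rewrite (muv _ _ xuv) (muv _ _ xuv').
- by move=> ab; apply: mab; rewrite ab; apply: cong_refl.
- by apply gE => -[].
- by apply gE => -[].
- by split; apply gE; [case|split; apply: cong_refl].
Qed.

Theorem theorem1p2 (d : Order.disp_t) (L : latticeType d) :
  finite_height L ->
  (exists (S : signature) (V : algebra S -> Prop) (A : algebra S),
     [/\ variety V, congruence_modular V, V A &
         lattice_isomorphic (congruence A) L]) ->
  (forces L (@solvable) generates_congruence_modular <->
   (forall (S : signature) (B : algebra S),
      congruence_modular (generated_variety B) ->
      lattice_isomorphic (congruence B) L -> solvable B)) /\
  ((forall (S : signature) (B : algebra S),
      congruence_modular (generated_variety B) ->
      lattice_isomorphic (congruence B) L -> solvable B) <->
   ~ lattice_homomorphic_image L bool).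
Proof.
(* Conditions (1) and (2) agree by unfolding [forces]. *)
move=> fh [S [V [A [vV mV VA AL]]]]; split; first by [].
split=> [sol imL|noim S' B mB BL].
  have imA := homomorphic_image_isomorphic (lattice_isomorphic_sym AL) imL.
  have [g [a [b [gc nab gaa gab [gba gbb]]]]] :=
    bool_image_meet_operation (finite_height_isomorphic AL fh) imA.
  apply: (expansion_not_solvable nab gaa gab gba gbb).
  apply: sol (modular_expansion vV mV VA) _.
  exact: lattice_isomorphic_trans (expansion_isomorphic gc) AL.
apply: contrapT => nsol; apply: noim; apply: (homomorphic_image_isomorphic BL).
exact: not_solvable_bool_image (finite_height_isomorphic BL fh) mB nsol.
Qed.
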